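(* Let $f=(\alpha_1\cdots\alpha_n)$ and $g=(\beta_1\cdots\beta_n)$ be $n$-player rules. Suppose that $(\alpha_i-\alpha_j)(\beta_i-\beta_j)>0$ for all $i\neq j$. Then $f\sim g$, i.e. $\mathrm{ord}_fP=\mathrm{ord}_gP$ for all $P\in\mathcal{L}$.
   Context: Positions are finite tuples $P=(a_1,\dots,a_k)$ of integers with $a_1\geqslant\dots\geqslant a_k\geqslant0$, where tuples differing only by trailing zeros are identified. $(0)$ is the empty position, $\mathcal{L}$ is the set of positions other than $(0)$, and $|P|=\sum a_i$ is the volume of $P$. A chomp move $P\to Q$ from $P=(a_1,\dots,a_k)$ chooses $1\leqslant x\leqslant k$ and an integer $a\geqslant0$, and sets $Q=(b_1,\dots,b_k)$ with $b_j=a_j$ for $j<x$ and $b_j=\min(a_j,a)$ for $j\geqslant x$, where $Q$ must be a different position from $P$. Write $\mathrm{Mov}P=\{Q:P\to Q\}$. An $n$-player rule is a tuple $f=(\alpha_1\cdots\alpha_n)$ of distinct real numbers. Ordinals $\mathrm{ord}_f$ are defined recursively on volume as follows. - $\mathrm{ord}_f(0)=0$. - For a position $Q$, set $s_f(Q)=\alpha_{\mathrm{ord}_fQ+1}$ if $\mathrm{ord}_fQ<n$ and $s_f(Q)=\alpha_1$ if $\mathrm{ord}_fQ=n$. - For $P\in\mathcal{L}$, $\mathrm{ord}_fP$ is the unique $i\in\{1,\dots,n\}$ with $\alpha_i=\max_{Q\in\mathrm{Mov}P}s_f(Q)$. Two rules $f,g$ are isomorphic, written $f\sim g$, if $\mathrm{ord}_fP=\mathrm{ord}_gP$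 for all $P\in\mathcal{L}$. *)

(* Defs.v *)
From HB Require Import structures.
From mathcomp Require Import all_boot all_order all_algebra.
From mathcomp Require Import boolp classical_sets reals.
From mathcomp Require Import zify.

Set Implicit Arguments.
Unset Strict Implicit.
Unset Printing Implicit Defensive.

Import Order.TTheory GRing.Theory Num.Theory.
Local Open Scope classical_set_scope.
Local Open Scope ring_scope.

(* Tuples are identified up to trailing zeros: a position is stored as its    *)
(* unique representative without zero entries.                                *)
Record position := Position {
  entries :> seq nat;
  _ : sorted geq entries && (0%N \notin entries) }.

HB.instance Definition _ := [isSub for entries].
HB.instance Definition _ := [Choice of position by <:].

Definition empty_position : position := @Position [::] isT.

Definition volume (P : position) : nat := sumn P.

(* The entry a_j, numbered from j = 1 and padded by zeros beyond the length;  *)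
(* two tuples are identified exactly when all their padded entries agree.     *)
Definition entry (P : position) (j : nat) : nat := nth 0%N P j.-1.

(* Choosing x beyond the number of nonzero entries would only give Q = P, so  *)
(* bounding x by [size P] does not depend on the representative.              *)
Definition move (P Q : position) : Prop :=
  exists x a : nat,
    [/\ (1 <= x <= size P)%N,
        forall j, (1 <= j)%N ->
          entry Q j = if (j < x)%N then entry P j else minn (entry P j) a
      & Q <> P].

Definition Mov (P : position) : set position := [set Q | move P Q].

Record rule (R : realType) (n : nat) := Rule {
  values :> n.-tuple R;
  _ : uniq values }.

Definition alpha (R : realType) (n : nat) (f : rule R n) (i : nat) : R :=
  nth 0 f i.-1.

(* s_f(Q) as a function of o = ord_f(Q), see [pos_score]. *)
Definition score (R : realType) (n : nat) (f : rule R n) (o : nat) : R :=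
  if (o < n)%N then alpha f o.+1 else alpha f 1.

Definition is_max (R : realType) (A : set R) (m : R) : Prop :=
  A m /\ ubound A m.

(* [ord_rec f m] is ord_f on positions of volume at most m; [xget 0] picks    *)
(* the index i, whose existence and uniqueness are [ordP] and [ord_unique].   *)
(* For n = 0 the index does not exist and [xget] returns 0.                   *)
Fixpoint ord_rec (R : realType) (n : nat) (f : rule R n) (m : nat)
    (P : position) : nat :=
  if m isn't m'.+1 then 0%N else
  if P == empty_position then 0%N else
  xget 0%N [set i : nat | (1 <= i <= n)%N /\
    is_max [set score f (ord_rec f m' Q) | Q in Mov P] (alpha f i)].

Definition ord (R : realType) (n : nat) (f : rule R n) (P : position) : nat :=
  ord_rec f (volume P) P.

Definition pos_score (R : realType) (n : nat) (f : rule R n)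
    (Q : position) : R :=
  score f (ord f Q).

Definition isomorphic (R : realType) (n : nat) (f g : rule R n) : Prop :=
  forall P : position, P <> empty_position -> ord f P = ord g P.

Lemma entry_gt0 (P : position) (j : nat) :
  (0 < nth 0 P j)%N = (j < size P)%N.
Proof.
case: (ltnP j (size P)) => h; last by rewrite nth_default.
case: P h => s0 /= /andP[_ s0n] h; rewrite lt0n; apply: contra s0n => /eqP <-.
exact: mem_nth.
Qed.

Lemma position_ext (P Q : position) : nth 0%N P =1 nth 0%N Q -> P = Q.
Proof.
move=> h; apply: val_inj => /=; apply: (@eq_from_nth _ 0%N) => [|i _] //.
have E j : (j < size P)%N = (j < size Q)%N by rewrite -!entry_gt0 h.
have := E (size P); have := E (size Q); lia.
Qed.

Lemma sumn_nth (t : seq nat) (m : nat) :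
  (size t <= m)%N -> sumn t = (\sum_(j < m) nth 0 t j)%N.
Proof.
elim: t m => [|b t IH] [|m] //= h.
- by rewrite big_ord0.
- by rewrite big1 // => i _; rewrite nth_nil.
- by rewrite big_ord_recl (IH m).
Qed.

Lemma move_nth (P Q : position) (j : nat) :
  move P Q -> (nth 0 Q j <= nth 0 P j)%N.
Proof.
move=> [x [a [_ h _]]]; have := h j.+1 isT; rewrite /entry /= => ->.
by case: ifP => // _; rewrite geq_minl.
Qed.

Lemma move_volume (P Q : position) : move P Q -> (volume Q < volume P)%N.
Proof.
move=> PQ; have le j := move_nth j PQ.
pose m := maxn (size P) (size Q).
rewrite /volume (@sumn_nth P m) ?leq_maxl // (@sumn_nth Q m) ?leq_maxr //.
rewrite ltn_neqAle leq_sum ?andbT; last by move=> i _; exact: le.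
apply/negP => e; case: PQ => x [a [_ _]]; apply; apply: position_ext => j.
have [jm|mj] := ltnP j m; last first.
  by rewrite !nth_default //; move: mj; rewrite geq_max => /andP[].
have := leqif_sum (fun (i : 'I_m) (_ : true) => leqif_eq (le i)).
by move=> /= [_]; rewrite e => /esym/forallP/(_ (Ordinal jm))/eqP.
Qed.

Lemma move_empty (P : position) :
  P <> empty_position -> move P empty_position.
Proof.
move=> P0; exists 1%N, 0%N; split.
- rewrite /= lt0n; apply/negP => /nilP e; apply: P0; exact: val_inj.
- by move=> [|j] // _; rewrite /entry /= nth_nil minn0.
- by move=> e; apply: P0.
Qed.

Lemma ord_recE (R : realType) (n : nat) (f : rule R n) (m : nat)
    (P : position) :
  (volume P <= m)%N -> ord_rec f m P = ord f P.
Proof.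
rewrite /ord; elim/ltn_ind: m P => m IH P hm.
have [->|/eqP P0] := eqVneq P empty_position; first by case: m {IH hm}.
have vP := move_volume (move_empty P0).
case: m IH hm => [|m] IH hm; first by move: vP; lia.
case ev: (volume P) => [|v]; first by move: vP; rewrite ev.
rewrite /=; case: eqP => // _; congr xget.
apply/seteqP; split=> i /= [hi]; (have E : forall Q, Mov P Q ->
    score f (ord_rec f m Q) = score f (ord_rec f v Q)
  by move=> Q /move_volume hQ; congr score;
     rewrite IH ?[RHS]IH //; lia);
  by rewrite (eq_imagel E).
Qed.

Lemma alpha_inj (R : realType) (n : nat) (f : rule R n) (i j : nat) :
  (1 <= i <= n)%N -> (1 <= j <= n)%N -> alpha f i = alpha f j -> i = j.
Proof.
case: f => t /= ut hi hj /eqP; rewrite /alpha /= nth_uniq // ?size_tuple; lia.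
Qed.

Lemma ord_empty (R : realType) (n : nat) (f : rule R n) :
  ord f empty_position = 0%N.
Proof. by []. Qed.

Lemma ord_unique (R : realType) (n : nat) (f : rule R n) (P : position)
    (i j : nat) :
  (1 <= i <= n)%N -> is_max [set pos_score f Q | Q in Mov P] (alpha f i) ->
  (1 <= j <= n)%N -> is_max [set pos_score f Q | Q in Mov P] (alpha f j) -> i = j.
Proof.
move=> hi [mi ui] hj [mj uj]; apply: (alpha_inj (f := f)) => //.
by apply/eqP; rewrite eq_le; apply/andP; split; [apply: uj|apply: ui].
Qed.

Lemma ordP (R : realType) (n : nat) (f : rule R n) (P : position) :
  (0 < n)%N -> P <> empty_position ->
  (1 <= ord f P <= n)%N /\
  is_max [set pos_score f Q | Q in Mov P] (alpha f (ord f P)).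
Proof.
move=> n0 P0.
have vP := move_volume (move_empty P0).
have -> : ord f P = xget 0%N [set i : nat | (1 <= i <= n)%N /\
    is_max [set pos_score f Q | Q in Mov P] (alpha f i)].
  rewrite -(@ord_recE _ _ _ (volume P).-1.+1); last by lia.
  rewrite /=; case: eqP => // _; congr xget.
  have E : forall Q, Mov P Q -> score f (ord_rec f (volume P).-1 Q) = pos_score f Q.
    by move=> Q /move_volume hQ; rewrite /pos_score; congr score; apply: ord_recE; lia.
  by rewrite (eq_imagel E).
have sE Q : exists2 i : 'I_n, true & pos_score f Q = alpha f i.+1.
  rewrite /pos_score /score; case: ifP => h; first by exists (Ordinal h).
  by exists (Ordinal n0).
pose A := [pred i : 'I_n | `[< exists2 Q, Mov P Q & pos_score f Q = alpha f i.+1 >]].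
have [i0 _ hi0] := sE empty_position.
have Ai0 : A i0 by apply/asboolP; exists empty_position => //; exact: move_empty.
case: (@arg_maxP _ _ _ i0 A (fun i => alpha f i.+1) Ai0) => i /asboolP[Q PQ hQ].
move=> imax; pose B := [set i : nat | (1 <= i <= n)%N /\
    is_max [set pos_score f Q | Q in Mov P] (alpha f i)].
suff : B (xget 0%N B) by [].
apply: (@xgetPex _ 0%N B); exists i.+1; split; first by rewrite /= ltn_ord.
split; first by exists Q.
move=> _ [Q' PQ' <-]; have [k _ hk] := sE Q'; rewrite hk; apply: imax.
by apply/asboolP; exists Q'.
Qed.

(* Main.v *)
Require Import Defs.
From mathcomp Require Import all_boot all_order all_algebra reals.
From mathcomp Require Import zify.
Import Order.TTheory GRing.Theory Num.Theory.
Local Open Scope ring_scope.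

(** The hypothesis says that [f] and [g] order the indices [1..n] in the same
    way. By induction on volume the positions reachable from [P] have the same
    ordinals for both rules, so their scores are the values of [f], resp. [g],
    at the same indices, and the same index realises both maxima. *)

(** Tracks a score by its index, which does not depend on the rule, so equal ordinals select the
    same index in [f] and [g]. *)
Definition score_index (n o : nat) : nat := if (o < n)%N then o.+1 else 1%N.

Lemma score_index_bounds (n o : nat) :
  (0 < n)%N -> (1 <= score_index n o <= n)%N.
Proof. by rewrite /score_index; case: ifP. Qed.

Lemma score_alpha (R : realType) (n : nat) (f : rule R n) (o : nat) :
  score f o = alpha f (score_index n o).
Proof. by rewrite /score /score_index; case: ifP. Qed.

(** Settles [n = 0], where [ordP] does not apply. *)
Lemma rule0_eq (R : realType) (f g : rule R 0) : f = g.
Proof.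
case: f g => [s us] [t ut]; have st : s = t by rewrite (tuple0 s) (tuple0 t).
by subst t; congr Rule; exact: bool_irrelevance.
Qed.

Lemma alpha_le_transfer (R : realType) (n : nat) (f g : rule R n) :
  (forall i j : nat, (1 <= i <= n)%N -> (1 <= j <= n)%N -> i <> j ->
    0 < (alpha f i - alpha f j) * (alpha g i - alpha g j)) ->
  forall i j : nat, (1 <= i <= n)%N -> (1 <= j <= n)%N ->
    alpha f i <= alpha f j -> alpha g i <= alpha g j.
Proof.
move=> h i j hi hj le_f; have [-> //|/eqP ij] := eqVneq i j.
have := h i j hi hj ij; rewrite -subr_le0 in le_f.
(* If [alpha g j < alpha g i], the factors have opposite weak signs. *)
by apply: contraTT; rewrite -ltNge -leNgt -subr_gt0 => /ltW; apply: mulr_le0_ge0.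
Qed.

Theorem theorem3p3 (R : realType) (n : nat) (f g : rule R n)
    (h : forall i j : nat, (1 <= i <= n)%N -> (1 <= j <= n)%N -> i <> j ->
      0 < (alpha f i - alpha f j) * (alpha g i - alpha g j)) :
  isomorphic f g.
Proof.
case: n f g h => [|n] f g h; first by rewrite (rule0_eq R f g).
move=> P; have [v] := ubnP (volume P); elim: v P => // v IH P vP P0.
have eq_ord Q : move P Q -> ord f Q = ord g Q.
  (* [IH] excludes the empty position, where both ordinals are 0. *)
  move=> /move_volume vQ; have [->|/eqP Q0] := eqVneq Q empty_position => //.
  by apply: IH => //; lia.
have [hi [[Q PQ fQ] ub]] := @ordP R n.+1 f P isT P0.
have [hj max_g] := @ordP R n.+1 g P isT P0.
(* It remains that [ord f P] realises the maximum for [g]. *)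
apply: (@ord_unique R n.+1 g P) => //; split.
  exists Q => //; rewrite /pos_score score_alpha -eq_ord //.
  (* The values of [f] are distinct, so [fQ] forces the score index of [Q] to be [ord f P]. *)
  congr alpha; apply: (@alpha_inj R n.+1 f) => //.
    exact: score_index_bounds.
  by rewrite -score_alpha.
move=> _ [Q' PQ' <-]; rewrite /pos_score score_alpha -eq_ord //.
apply: alpha_le_transfer h _ _ _ _ _ => //; first exact: score_index_bounds.
by rewrite -score_alpha; apply: ub; exists Q'.
Qed.
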